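(* Let $\Omega$ be a perfectly normal topological space and let $A$ be a non-empty $G_\delta$-subset of $\Omega$. Let $f\in\mathscr{B}_1^{bd}(A)$ satisfy $f\geq 0$ and $\sup_{x\in A}f(x)=1$. Then there is a sequence $(G_n)_{n=0}^\infty$ of subsets of $\Omega$, each of which is both an $F_\sigma$- and a $G_\delta$-subset of $\Omega$, such that the function $$\overline{f}(x):=\frac{1}{2}\sum_{n=0}^\infty\left(\frac{2}{3}\right)^{n+1}\chi_{G_n}(x),\qquad x\in\Omega,$$ (the series converging uniformly on $\Omega$) is a non-negative extension of $f$ with $\sup_{x\in\Omega}\overline{f}(x)=1$.
   Context: For a topological space $X$, $\mathscr{B}_1(X)$ denotes the space of all functions $X\to\mathbb{R}$ of the first Baire class, i.e. pointwise limits of sequences of continuous real-valued functions on $X$; $\mathscr{B}_1^{bd}(X)$ is the family of bounded elements of $\mathscr{B}_1(X)$. A subset $A\subset\Omega$ carries the subspace topology. $\chi_G$ is the characteristic function of $G\subset\Omega$. $F_\sigma$-sets are countable unions of closed sets; $G_\delta$-sets are countable intersections of open sets. *)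

(* Defs.v *)
From HB Require Import structures.
From mathcomp Require Export all_boot all_order all_algebra.
From mathcomp Require Export all_classical all_reals all_analysis.
From mathcomp Require Export borel_hierarchy.
Export Order.TTheory GRing.Theory Num.Theory numFieldNormedType.Exports.

Set Implicit Arguments.
Unset Strict Implicit.
Unset Printing Implicit Defensive.

Local Open Scope classical_set_scope.
Local Open Scope ring_scope.

(* No separation axiom such as T1 is included in normality. *)
Definition perfectly_normal_space (T : topologicalType) : Prop :=
  normal_space T /\ forall F : set T, closed F -> Gdelta F.

Definition baire1 (R : realType) (X : topologicalType) (f : X -> R) : Prop :=
  exists2 g : nat -> X -> R, (forall n, continuous (g n)) &
    forall x, g n x @[n --> \oo] --> f x.

Definition baire1_bd (R : realType) (X : topologicalType) (f : X -> R) : Prop :=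
  baire1 f /\ bounded_fun f.

(* Main.v *)
(** Let [h] be the current remainder on [A], with values in [[0, r]] where
    [r = (2/3)^n].  The sets where [h >= 2r/3] and [h <= r/3] are disjoint
    G_delta sets of [Omega], so in a perfectly normal space a set [G] that is
    both F_sigma and G_delta separates them, and [h - (r/3) 1_G] takes values
    in [[0, 2r/3]].  Iterating from [h = f] expands [f] as the required series.
    The remainders need not be known to be of the first Baire class: it is
    enough that their weak sub- and superlevel sets stay G_delta.  As the [G]s
    live in [Omega], the series itself is the extension. *)

Require Import Defs.
From mathcomp Require Import lra ring.

Local Open Scope classical_set_scope.
Local Open Scope ring_scope.

(** * Operations on G_delta sets *)

Lemma Gdelta_bigcap {T : topologicalType} {F : nat -> set T} :
  (forall i, Gdelta (F i)) -> Gdelta (\bigcap_i F i).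
Proof.
move=> GF.
have /choice[U HU] : forall i, exists U : nat -> set T,
    (forall j, open (U j)) /\ F i = \bigcap_j U j.
  by move=> i; have [U oU ->] := GF i; exists U.
(* The double intersection is indexed by codes of pairs; a code of no pair contributes the neutral
   [setT]. *)
exists (fun k => if @unpickle (nat * nat)%type k is Some p then U p.1 p.2
                 else setT).
  by move=> k; case: unpickle => [p|]; [exact: (HU p.1).1 | exact: openT].
apply/seteqP; split => [x Fx k _|x Ux i _].
  case: unpickle => [[i j]|//] /=.
  by have := Fx i I; rewrite (HU i).2; exact.
rewrite (HU i).2 => j _.
by have := Ux (pickle (i, j)) I; rewrite pickleK.
Qed.

Lemma GdeltaI {T : topologicalType} {A B : set T} :
  Gdelta A -> Gdelta B -> Gdelta (A `&` B).
Proof.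
move=> GA GB.
rewrite (_ : A `&` B = \bigcap_i (if i is 0%N then A else B)); last first.
  apply/seteqP; split => [x [Ax Bx] [|i]//|x ABx].
  by split; [exact: (ABx 0%N) | exact: (ABx 1%N)].
by apply: Gdelta_bigcap => -[|i].
Qed.

Lemma GdeltaU {T : topologicalType} {A B : set T} :
  Gdelta A -> Gdelta B -> Gdelta (A `|` B).
Proof.
move=> [U oU ->] [V oV ->].
rewrite (_ : _ `|` _ = \bigcap_i \bigcap_j (U i `|` V j)); last first.
  apply/seteqP; split => [x [Ux|Vx] i _ j _|x UVx].
  - by left; exact: Ux.
  - by right; exact: Vx.
  - have [Ux|/existsNP[i /not_implyP[_ nUx]]] :=
      pselect ((\bigcap_i U i) x); first by left.
    by right => j _; case: (UVx i I j I).
do 2! (apply: Gdelta_bigcap => ?).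
by apply: open_Gdelta; exact: openU.
Qed.

Lemma Gdelta_setC_Fsigma {T : topologicalType} {A : set T} :
  Gdelta (~` A) -> Fsigma A.
Proof.
move=> [U oU AU]; exists (fun i => ~` U i) => [i|].
  exact: open_closedC.
by rewrite -setC_bigcap -AU setCK.
Qed.

Lemma Fsigma_setC_Gdelta {T : topologicalType} {A : set T} :
  Fsigma A -> Gdelta (~` A).
Proof.
move=> [F cF ->]; exists (fun i => ~` F i) => [i|].
  exact: closed_openC.
by rewrite setC_bigcup.
Qed.

Lemma Gdelta_preimage {X Y : topologicalType} {g : X -> Y} {B : set Y} :
  continuous g -> Gdelta B -> Gdelta (g @^-1` B).
Proof.
move=> /continuousP cg [U oU ->]; exists (fun i => g @^-1` U i).
  by move=> i; exact: cg.
by rewrite preimage_bigcap.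
Qed.

(** Open sets of the subspace are traces of open sets of [T], so the image is [A] cut by a G_delta
    set of [T]; [A] being G_delta does the rest. *)
Lemma Gdelta_image_set_val {T : topologicalType} {A : set T} {B : set A} :
  Gdelta A -> Gdelta B -> Gdelta (set_val @` B).
Proof.
move=> GA [U oU ->].
have /choice[V HV] : forall i, exists V : set T, open V /\ set_val @^-1` V = U i.
  by move=> i; have [V oV <-] := oU i; exists V.
rewrite (_ : _ @` _ = A `&` \bigcap_i V i); last first.
  apply/seteqP; split => [x [a Ua <-]|x [Ax Vx]].
    split; first exact/set_mem/valP.
    by move=> i _; have := Ua i I; rewrite -(HV i).2.
  exists (SigSub (mem_set Ax)) => // i _.
  by rewrite -(HV i).2; exact: Vx.
apply: GdeltaI => //; apply: Gdelta_bigcap => i.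
exact/open_Gdelta/(HV i).1.
Qed.

(** * Separation of disjoint G_delta sets *)

Lemma open_ltn_forall {T : topologicalType} (V : nat -> set T) (k : nat) :
  (forall i, open (V i)) -> open [set x | forall m, (m < k)%N -> V m x].
Proof.
move=> oV; elim: k => [|k IHk].
  by rewrite (_ : mkset _ = setT); [exact: openT | apply/seteqP; split].
rewrite (_ : mkset _ = [set x | forall m, (m < k)%N -> V m x] `&` V k).
  exact: openI.
apply/seteqP; split => [x Vx|x [Vx Vkx] m].
  by split; [move=> m mk; exact/Vx/ltnW | exact: Vx].
by rewrite ltnS leq_eqVlt => /orP[/eqP -> //|/Vx].
Qed.

(* Membership of x in the separating set only depends on which of the two
   sequences of open sets x leaves first. *)
Lemma Gdelta_separation {T : topologicalType} {P Q : set T} :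
  perfectly_normal_space T -> Gdelta P -> Gdelta Q -> P `&` Q = set0 ->
  exists G, [/\ Fsigma G, Gdelta G, P `<=` G & Q `<=` ~` G].
Proof.
move=> [_ pT] [U oU PU] [V oV QV] PQ0.
have first_exit_Gdelta (k : nat -> nat) (U' V' : nat -> set T) :
    (forall i, open (U' i)) -> (forall i, open (V' i)) ->
  Gdelta [set x | forall n, (forall m, (m < k n)%N -> V' m x) -> U' n x].
  move=> oU' oV'.
  rewrite (_ : mkset _ =
      \bigcap_n (~` [set x | forall m, (m < k n)%N -> V' m x] `|` U' n)).
    apply: Gdelta_bigcap => n; apply: GdeltaU; last exact: open_Gdelta.
    (* The premise fails on a closed set, which is G_delta by perfect normality. *)
    by apply: pT; apply: open_closedC; exact: open_ltn_forall.
  apply/seteqP; split => [x Gx n _|x Gx n Vx].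
    have [Vx|] := pselect (forall m, (m < k n)%N -> V' m x); last by left.
    by right; exact: Gx.
  by case: (Gx n I).
(* Let u and v be the first indices at which [x] leaves [U] and [V], possibly infinite. Then [G]
   means v <= u and [C] means u < v, except that both hold when u and v are infinite, that is on the
   empty set [P] [&] [Q]. *)
pose G := [set x | forall n, (forall m, (m < n.+1)%N -> V m x) -> U n x].
pose C := [set x | forall n, (forall m, (m < n)%N -> U m x) -> V n x].
have GC : ~` G = C.
  apply/seteqP; split => [x /existsNP[n /not_implyP[Vx nUx]] n' Ux|x Cx Gx].
    apply: Vx; rewrite ltnS leqNgt; apply/negP => nn'.
    exact/nUx/Ux.
  (* A point of both sets never leaves: [C] gives [V n] from the earlier [U], then [G] gives
     [U n]. *)
  have UV n : U n x /\ V n x.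
    elim/ltn_ind: n => n IHn.
    have Vn : V n x by apply: Cx => m /IHn[].
    split=> //; apply: Gx => m.
    by rewrite ltnS leq_eqVlt => /orP[/eqP -> //|/IHn[]].
  rewrite -[False]/(set0 x) -PQ0 PU QV.
  by split=> n _; [exact: (UV n).1 | exact: (UV n).2].
exists G; split.
- by apply: Gdelta_setC_Fsigma; rewrite GC; exact: first_exit_Gdelta id _ _ _ _.
- exact: (first_exit_Gdelta succn).
- by rewrite PU => x Px n _; exact: Px.
- by rewrite GC QV => x Qx n _; exact: Qx.
Qed.

(** * Level sets of functions of the first Baire class *)

Lemma baire1N {R : realType} {X : topologicalType} {f : X -> R} :
  baire1 f -> baire1 (\- f).
Proof.
move=> [g cg gf]; exists (fun n => \- g n).
  by move=> n x; apply: continuousN; exact: cg.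
by move=> x; apply: cvgN; exact: gf.
Qed.

(** [c <= f x] holds iff, for every [m], [g k x] exceeds [c - 1/(m+1)] for arbitrarily large [k];
    each [U m N] below is a union of open sets. *)
Lemma baire1_ge_Gdelta {R : realType} {X : topologicalType} {f : X -> R} (c : R) :
  baire1 f -> Gdelta [set x | c <= f x].
Proof.
move=> [g cg gf].
pose U m N := [set x | exists2 k, (N <= k)%N & c - m.+1%:R^-1 < g k x].
rewrite (_ : mkset _ = \bigcap_m \bigcap_N U m N); last first.
  apply/seteqP; split => [x /= cfx m _ N _|x Ux /=].
    have e0 : 0 < m.+1%:R^-1 :> R by rewrite invr_gt0 ltr0n.
    have cf : c - m.+1%:R^-1 < f x by rewrite (lt_le_trans _ cfx)// gtrBl.
    have [M _ HM] := cvgr_gt _ (gf x) _ cf.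
    exists (maxn N M); first exact: leq_maxl.
    by apply: HM => /=; exact: leq_maxr.
  rewrite leNgt; apply/negP => fxc.
  have [m fm] : exists m, f x < c - m.+1%:R^-1.
    have d0 : 0 < c - f x by rewrite subr_gt0.
    have [m /= mlt] := ltr_add_invr d0.
    by exists m; rewrite ltrBrDr -ltrBrDl; rewrite add0r in mlt.
  have [M _ HM] := cvgr_lt _ (gf x) _ fm.
  have [k Mk] := Ux m I M I.
  by have := HM k Mk => /= h1 h2; have := lt_trans h1 h2; rewrite ltxx.
apply: Gdelta_bigcap => m; apply: Gdelta_bigcap => N; apply: open_Gdelta.
rewrite (_ : U m N = \bigcup_(k in [set k | (N <= k)%N])
    (g k @^-1` [set y | c - m.+1%:R^-1 < y])); last first.
  by apply/seteqP; split => x [k ? ?]; exists k.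
apply: bigcup_open => k _.
by move: (cg k) => /continuousP; apply; exact: open_gt.
Qed.

(** By complements, preimages of open rays, hence of all open sets of reals, are F_sigma: these are
    the functions of the first Borel class. *)
Definition Gdelta_levels {R : realType} {X : topologicalType} (h : X -> R) :=
  forall c, Gdelta [set x | c <= h x] /\ Gdelta [set x | h x <= c].

Lemma baire1_Gdelta_levels {R : realType} {X : topologicalType} {f : X -> R} :
  baire1 f -> Gdelta_levels f.
Proof.
move=> bf c; split; first exact: baire1_ge_Gdelta.
have := baire1_ge_Gdelta (- c) (baire1N bf).
by congr Gdelta; apply/seteqP; split => x /=; rewrite lerN2.
Qed.

Lemma Gdelta_levelsB_indic {R : realType} {X : topologicalType} {h : X -> R}
    {H : set X} (b : R) :
  Gdelta_levels h -> Gdelta H -> Gdelta (~` H) ->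
  Gdelta_levels (fun x => h x - b * \1_H x).
Proof.
move=> lh GH GHC c.
have E x : h x - b * \1_H x = if x \in H then h x - b else h x.
  by rewrite indicE; case: ifP => _; rewrite ?mulr1 // mulr0 subr0.
split.
  rewrite (_ : mkset _ = ([set x | c + b <= h x] `&` H) `|`
                         ([set x | c <= h x] `&` ~` H)).
    by apply: GdeltaU; apply: GdeltaI => //; apply lh.
  apply/seteqP; split => x /=; rewrite E; case: ifPn.
  - by move=> /set_mem Hx; rewrite lerBrDr; left.
  - by rewrite notin_setE => Hx; right.
  - by move=> /set_mem Hx; rewrite lerBrDr => -[[]|[]].
  - by rewrite notin_setE => Hx [[]|[]].
rewrite (_ : mkset _ = ([set x | h x <= c + b] `&` H) `|`
                       ([set x | h x <= c] `&` ~` H)).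
  by apply: GdeltaU; apply: GdeltaI => //; apply lh.
apply/seteqP; split => x /=; rewrite E; case: ifPn.
- by move=> /set_mem Hx; rewrite lerBlDr; left.
- by rewrite notin_setE => Hx; right.
- by move=> /set_mem Hx; rewrite lerBlDr => -[[]|[]].
- by rewrite notin_setE => Hx [[]|[]].
Qed.

(** * Expansion of the function on [A] *)

Lemma remainder_step {R : realType} {T : topologicalType} {A : set T}
    {h : A -> R} {r : R} :
  perfectly_normal_space T -> Gdelta A -> 0 < r ->
  Gdelta_levels h -> (forall a, 0 <= h a <= r) ->
  exists G : set T, [/\ Fsigma G, Gdelta G &
    let h' a := h a - r / 3 * \1_G (set_val a) in
    Gdelta_levels h' /\ forall a, 0 <= h' a <= 2 / 3 * r].
Proof.
move=> pT GA r0 lh hr.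
have [|G [FG GG PG QG]] := Gdelta_separation pT
    (Gdelta_image_set_val GA (lh (2 / 3 * r)).1)
    (Gdelta_image_set_val GA (lh (1 / 3 * r)).2).
  apply/seteqP; split => // _ [[a /= ha <-]] [b /= hb] /val_inj ba.
  rewrite ba in hb; lra.
have cval : continuous (set_val : A -> T) by exact: initial_continuous.
exists G; split => //; split.
  apply: (@Gdelta_levelsB_indic _ _ _ (set_val @^-1` G)) => //.
    exact: Gdelta_preimage.
  by rewrite preimage_setC; apply: Gdelta_preimage => //; exact: Fsigma_setC_Gdelta.
(* On [G], [h] exceeds r/3, and off [G] it is below 2r/3, so both cases land in [0, 2r/3]. *)
move=> a; have := hr a; rewrite indicE; case: (boolP (_ \in G)) => /=.
  move=> /set_mem Ga /andP[h0 h1]; rewrite mulr1.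
  have : ~ h a <= 1 / 3 * r by move=> ha; apply: (QG (set_val a)) => //; exists a.
  by move=> /negP; rewrite -ltNge => ?; apply/andP; split; lra.
rewrite notin_setE => nGa /andP[h0 h1]; rewrite mulr0 subr0.
have : ~ 2 / 3 * r <= h a by move=> ha; apply: nGa; apply: PG; exists a.
by move=> /negP; rewrite -ltNge => ?; apply/andP; split; lra.
Qed.

Lemma remainder_sequence {R : realType} {T : topologicalType} {A : set T}
    {f : A -> R} :
  perfectly_normal_space T -> Gdelta A ->
  Gdelta_levels f -> (forall a, 0 <= f a <= 1) ->
  exists2 G : nat -> set T, forall n, Fsigma (G n) /\ Gdelta (G n) &
    forall (n : nat) (a : A),
      0 <= f a - 1 / 2 * series (fun k => (2 / 3) ^+ k.+1 * \1_(G k) (set_val a)) n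
        <= (2 / 3) ^+ n.
Proof.
move=> pT GA lf f01.
pose inv n (h : A -> R) := Gdelta_levels h /\ forall a, 0 <= h a <= (2 / 3) ^+ n.
pose next n (h : A -> R) (G : set T) (a : A) :=
  h a - (2 / 3) ^+ n / 3 * \1_G (set_val a).
(* Choosing a set for every pair of stage and function, with [set0] as dummy when the invariant
   fails, lets the recursion below be defined before the invariant is proved. *)
have /choice[g Hg] (p : nat * (A -> R)) : exists G : set T, inv p.1 p.2 ->
    [/\ Fsigma G, Gdelta G & inv p.1.+1 (next p.1 p.2 G)].
  have [[lh hr]|] := pselect (inv p.1 p.2); last by exists set0.
  have r0 : 0 < (2 / 3) ^+ p.1 :> R by apply: exprn_gt0; lra.
  have [G [FG GG [lh' hr']]] := remainder_step pT GA r0 lh hr.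
  by exists G => _; split=> //; split=> // a; rewrite exprS; exact: hr'.
pose h := fix h n := if n is m.+1 then next m (h m) (g (m, h m)) else f.
have invh n : inv n (h n).
  elim: n => [|n /(Hg (n, h n))[]//].
  by split=> // a; rewrite expr0.
exists (fun n => g (n, h n)) => [n|n a].
  by have [] := Hg (n, h n) (invh n).
suff -> : f a - 1 / 2 * series
    (fun k => (2 / 3) ^+ k.+1 * \1_(g (k, h k)) (set_val a)) n = h n a.
  exact: (invh n).2.
elim: n => [|n IHn]; first by rewrite /series /= big_geq // mulr0 subr0.
(* The sum telescopes because (1/2)(2/3)^(n+1) = (2/3)^n / 3, the amount removed at stage [n]. *)
rewrite /= /next -IHn !seriesEnat /= big_nat_recr //= exprS.
by field.
Qed.

(** * Convergence of the series and the extension *)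

Lemma weighted_indicator_series_bounds (R : realType) {T : Type}
    (G : nat -> set T) (x : T) (n : nat) :
  let S : nat -> R := series (fun n => (2 / 3) ^+ n.+1 * \1_(G n) x) in
  S n <= limn S /\ limn S <= S n + 2 * (2 / 3) ^+ n.
Proof.
move=> S.
have two_thirds_ge0 k : 0 <= (2 / 3) ^+ k :> R by apply: exprn_ge0; lra.
have SS k : S k.+1 = S k + (2 / 3) ^+ k.+1 * \1_(G k) x.
  by rewrite /S !seriesEnat /= big_nat_recr.
have S_homo : {homo S : k m / (k <= m)%N >-> k <= m}.
  by apply/nondecreasing_seqP => k; rewrite SS lerDl mulr_ge0.
(* The upper bounds decrease because sum_(k >= n) (2/3)^(k+1) = 2 (2/3)^n. *)
have S_tail_homo :
    {homo (fun k => S k + 2 * (2 / 3) ^+ k) : k m / (k <= m)%N >-> m <= k}.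
  apply/nonincreasing_seqP => k; rewrite SS exprS.
  have := two_thirds_ge0 k; rewrite indicE; case: (_ \in _) => /= ?; lra.
(* [limn] has a default value on divergent sequences, so convergence comes before any bound on the
   limit. *)
have S_cvg : cvgn S.
  apply: nondecreasing_is_cvgn; first exact: S_homo.
  exists (S 0%N + 2) => _ [k _ <-].
  have := S_tail_homo _ _ (leq0n k); rewrite expr0 mulr1.
  by have := two_thirds_ge0 k; lra.
split; first exact: nondecreasing_cvgn_le.
apply: limr_le => //; exists n => //= m nm.
apply: le_trans (S_tail_homo _ _ nm); rewrite lerDl.
exact: mulr_ge0.
Qed.

Theorem theorem3p3 (R : realType) (Omega : topologicalType) (A : set Omega)
    (f : set_type A -> R) :
  perfectly_normal_space Omega ->
  A !=set0 ->
  Gdelta A ->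
  baire1_bd f ->
  (forall a, 0 <= f a) ->
  sup (range f) = 1 ->
  exists G : nat -> set Omega,
    let S (x : Omega) : nat -> R :=
      series (fun n : nat => (2 / 3) ^+ n.+1 * \1_(G n) x) in
    let fbar (x : Omega) : R := 1 / 2 * limn (S x) in
    [/\ forall n, Fsigma (G n) /\ Gdelta (G n),
        {uniform [set: Omega],
          (fun (N : nat) (x : Omega) => 1 / 2 * S x N) @ \oo --> fbar},
        forall x, 0 <= fbar x,
        forall a : set_type A, fbar (set_val a) = f a
      & sup (range fbar) = 1].
Proof.
move=> pT [x0 Ax0] GA [bf bdf] f0 supf.
(* [sup] is known to dominate the range only once an upper bound exists. Boundedness provides every
   constant beyond [M], hence [M + 1]. *)
have ubf : has_ubound (range f).
  have [M [_ HM]] := bdf.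
  exists (M + 1) => _ [a _ <-].
  by apply: le_trans (ler_norm _) _; apply: (HM (M + 1)) => //; lra.
have f01 a : 0 <= f a <= 1.
  by rewrite f0 -supf /=; apply: ub_le_sup => //; exists a.
have [G ambG Gf] := remainder_sequence pT GA (baire1_Gdelta_levels bf) f01.
exists G => S fbar.
have bounds x n : S x n <= limn (S x) /\ limn (S x) <= S x n + 2 * (2 / 3) ^+ n.
  exact: weighted_indicator_series_bounds.
have S0 x : S x 0%N = 0 by rewrite /S /series /= big_geq.
have geo0 : (2 / 3) ^+ n @[n --> \oo] --> (0 : R).
  by apply: cvg_expr; rewrite ger0_norm; lra.
have fbar01 x : 0 <= fbar x <= 1.
  have := bounds x 0%N; rewrite S0 expr0 /fbar => -[? ?].
  by apply/andP; split; lra.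
have fbarA (a : set_type A) : fbar (set_val a) = f a.
  (* Both values exceed half the [n]-th partial sum by at most (2/3)^n, so they differ by less than
     any [e]. *)
  apply/eqP; rewrite -subr_eq0 -normr_le0; apply/ler_addgt0Pr => e e0.
  have [n _ /(_ n (leqnn n)) /= ne] := cvgr_lt _ geo0 e e0.
  have : 0 <= f a - 1 / 2 * S (set_val a) n <= (2 / 3) ^+ n := Gf n a.
  have := bounds (set_val a) n; rewrite /fbar.
  move=> [? ?] /andP[? ?].
  by rewrite add0r ler_norml; apply/andP; split; lra.
split=> //.
(* The error bound (2/3)^n is independent of [x], so one [N] serves all points. *)
- move=> B /uniform_nbhs[E [entE EB]].
  have [e /= e0 ballE] : exists2 e : R, 0 < e & forall u v, `|u - v| < e -> E (u, v).
    have [e e0 He] := entE.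
    by exists e => // u v uv; apply: He.
  have [N _ HN] := cvgr_lt _ geo0 e e0.
  exists N => // n Nn; apply: EB => x _ /=; apply: ballE.
  have := HN n Nn; have := bounds x n; rewrite /fbar /=.
  by move=> [? ?] ?; rewrite ltr_norml; apply/andP; split; lra.
- by move=> x; have /andP[] := fbar01 x.
apply/eqP; rewrite eq_le; apply/andP; split.
  apply: ge_sup; first by exists (fbar x0), x0.
  by move=> _ [x _ <-]; have /andP[] := fbar01 x.
(* The range of [fbar] contains that of [f], so its supremum is at least 1. *)
rewrite -supf; apply: ge_sup.
  by pose a : A := SigSub (mem_set Ax0); exists (f a), a.
move=> _ [a _ <-]; apply: ub_le_sup; last by exists (set_val a).
by exists 1 => _ [x _ <-]; have /andP[] := fbar01 x.
Qed.
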